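(* Consistency in $\mathcal{SSCC}$ is undecidable, even if the numerical constraints occurring in the TBox contain no transitive roles and no constants other than $0$ or $1$.
   Context: QFBAPA constraints: set constraints $s\subseteq t$, $s=t$ over set terms built from set variables, $\emptyset$, $\mathcal{U}$ using $\cap,\cup,{}^c$; numerical constraints $\ell=\ell'$, $\ell<\ell'$, $n\mathrel{\mathsf{div}}\ell$ over PA expressions $n_0+n_1|s_1|+\dots+n_k|s_k|$ ($n_i\in\mathbb{N}$). $\mathcal{ALCSCC}$ concepts are concept names $A$, $\neg C$, $C\sqcap D$ and $\mathsf{succ}(\mathfrak{con})$ with $\mathfrak{con}$ a set or numerical constraint whose set variables are role names and concepts. Interpretations must be finitely branching (each $d$ has finitely many role successors $\mathsf{ars}^\mathcal{I}(d)=\bigcup_r r^\mathcal{I}(d)$); $d\in\mathsf{succ}(\mathfrak{con})^\mathcal{I}$ iff $\mathfrak{con}$ holds under $\mathcal{U}\mapsto\mathsf{ars}^\mathcal{I}(d)$, $r\mapsto r^\mathcal{I}(d)$, $C\mapsto C^\mathcal{I}\cap\mathsf{ars}^\mathcal{I}(d)$. $\mathcal{SSCC}$ extends $\mathcal{ALCSCC}$ with transitivity axioms $\mathsf{trans}(r)$ in the TBox (a finite set of CIs $C\sqsubseteq D$ and transitivity axioms), requiring $r^\mathcal{I}$ to be transitive in models; a role name is transitive if it occurs in such an axiom. A TBox is consistent if it has a finitely branching model. ''No constants other than 0 or 1'' means all natural-number constants and coefficients in numerical constraints are $0$ or $1$. *)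

(* Defs.v *)
From mathcomp Require Import all_boot finmap.
From mathcomp Require Import boolp classical_sets functions cardinality.
From Stdlib Require List Cantor.

Set Implicit Arguments.
Unset Strict Implicit.
Unset Printing Implicit Defensive.

Local Open Scope classical_set_scope.

(* Concept names and role names are two separate copies of nat.  The set       *)
(* variables of a constraint are role names (SRole) and arbitrary concepts     *)
(* (SConcept), hence the mutual recursion.  The expression                     *)
(* n0 + n1|s1| + ... + nk|sk| is PAdd (... (PAdd (PConst n0) n1 s1) ...) nk sk *)
Inductive concept : Type :=
  | CName of nat
  | CNot of concept
  | CAnd of concept & concept
  | CSucc of constraint
with constraint : Type :=
  | SetSub of sterm & sterm
  | SetEq of sterm & sterm
  | NumEq of paexpr & paexpr
  | NumLt of paexpr & paexpr
  | NumDiv of nat & paexpr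
with sterm : Type :=
  | SRole of nat
  | SConcept of concept
  | SEmpty
  | SUniv
  | SInter of sterm & sterm
  | SUnion of sterm & sterm
  | SCompl of sterm
with paexpr : Type :=
  | PConst of nat
  | PAdd of paexpr & nat & sterm.

Inductive axiom : Type :=
  | CI of concept & concept
  | Trans of nat.

Definition tbox := seq axiom.

(* The domain is nonempty because it is a pointedType; classically every       *)
(* nonempty type carries such a structure.                                     *)
Record interp := Interp {
  dom : pointedType;
  cname_int : nat -> set dom;
  role_int : nat -> dom -> set dom  (* role_int r d = r-successors of d *)
}.

Definition ars (I : interp) (d : dom I) : set (dom I) :=
  \bigcup_(r in [set: nat]) role_int r d.

Definition finitely_branching (I : interp) : Prop :=
  forall d : dom I, finite_set (ars d).

Section Semantics.
Variable I : interp.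

(* The cardinality #|` fset_set A | is the intended one only for finite A,     *)
(* which is always the case below in finitely branching interpretations.       *)
Fixpoint concept_ext (C : concept) : set (dom I) :=
  match C with
  | CName A => cname_int A
  | CNot D => ~` concept_ext D
  | CAnd D E => concept_ext D `&` concept_ext E
  | CSucc con => [set d | holds con d]
  end
with holds (con : constraint) (d : dom I) : Prop :=
  match con with
  | SetSub s t => sterm_ext s d `<=` sterm_ext t d
  | SetEq s t => sterm_ext s d = sterm_ext t d
  | NumEq l l' => paexpr_val l d = paexpr_val l' d
  | NumLt l l' => paexpr_val l d < paexpr_val l' d
  | NumDiv n l => n %| paexpr_val l d
  end
with sterm_ext (s : sterm) (d : dom I) : set (dom I) :=
  match s with
  | SRole r => role_int r d
  | SConcept C => concept_ext C `&` ars d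
  | SEmpty => set0
  | SUniv => ars d
  | SInter t u => sterm_ext t d `&` sterm_ext u d
  | SUnion t u => sterm_ext t d `|` sterm_ext u d
  | SCompl t => ars d `\` sterm_ext t d
  end
with paexpr_val (l : paexpr) (d : dom I) : nat :=
  match l with
  | PConst n => n
  | PAdd l' n s => paexpr_val l' d + n * #|` fset_set (sterm_ext s d) |
  end.

End Semantics.

Arguments concept_ext : clear implicits.

Definition satisfies (I : interp) (ax : axiom) : Prop :=
  match ax with
  | CI C D => concept_ext I C `<=` concept_ext I D
  | Trans r => forall d e f : dom I,
      role_int r d e -> role_int r e f -> role_int r d f
  end.

Definition model (I : interp) (T : tbox) : Prop :=
  forall ax : axiom, List.In ax T -> satisfies I ax.

Definition consistent (T : tbox) : Prop :=
  exists I : interp, finitely_branching I /\ model I T.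

Definition transitive_roles (T : tbox) : seq nat :=
  pmap (fun ax => if ax is Trans r then Some r else None) T.

(* Role names occurring at any depth, in particular inside the concepts that   *)
(* are used as set variables.                                                  *)
Fixpoint concept_roles (C : concept) : seq nat :=
  match C with
  | CName _ => [::]
  | CNot D => concept_roles D
  | CAnd D E => concept_roles D ++ concept_roles E
  | CSucc con => constraint_roles con
  end
with constraint_roles (con : constraint) : seq nat :=
  match con with
  | SetSub s t | SetEq s t => sterm_roles s ++ sterm_roles t
  | NumEq l l' | NumLt l l' => paexpr_roles l ++ paexpr_roles l'
  | NumDiv _ l => paexpr_roles l
  end
with sterm_roles (s : sterm) : seq nat :=
  match s with
  | SRole r => [:: r]
  | SConcept C => concept_roles C
  | SEmpty | SUniv => [::]
  | SInter t u | SUnion t u => sterm_roles t ++ sterm_roles u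
  | SCompl t => sterm_roles t
  end
with paexpr_roles (l : paexpr) : seq nat :=
  match l with
  | PConst _ => [::]
  | PAdd l' _ s => paexpr_roles l' ++ sterm_roles s
  end.

(* All constraints occurring at any depth.                                     *)
Fixpoint concept_constraints (C : concept) : seq constraint :=
  match C with
  | CName _ => [::]
  | CNot D => concept_constraints D
  | CAnd D E => concept_constraints D ++ concept_constraints E
  | CSucc con => con :: inner_constraints con
  end
with inner_constraints (con : constraint) : seq constraint :=
  match con with
  | SetSub s t | SetEq s t => sterm_constraints s ++ sterm_constraints t
  | NumEq l l' | NumLt l l' => paexpr_constraints l ++ paexpr_constraints l'
  | NumDiv _ l => paexpr_constraints l
  end
with sterm_constraints (s : sterm) : seq constraint :=
  match s with
  | SConcept C => concept_constraints C
  | SRole _ | SEmpty | SUniv => [::]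
  | SInter t u | SUnion t u => sterm_constraints t ++ sterm_constraints u
  | SCompl t => sterm_constraints t
  end
with paexpr_constraints (l : paexpr) : seq constraint :=
  match l with
  | PConst _ => [::]
  | PAdd l' _ s => paexpr_constraints l' ++ sterm_constraints s
  end.

Definition axiom_constraints (ax : axiom) : seq constraint :=
  match ax with
  | CI C D => concept_constraints C ++ concept_constraints D
  | Trans _ => [::]
  end.

Definition tbox_constraints (T : tbox) : seq constraint :=
  flatten (map axiom_constraints T).

Definition numerical (con : constraint) : bool :=
  match con with
  | SetSub _ _ | SetEq _ _ => false
  | NumEq _ _ | NumLt _ _ | NumDiv _ _ => true
  end.

Fixpoint paexpr_constants (l : paexpr) : seq nat :=
  match l with
  | PConst n => [:: n]
  | PAdd l' n _ => rcons (paexpr_constants l') n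
  end.

(* Constants of nested constraints are not listed here: those constraints are  *)
(* themselves members of tbox_constraints.                                     *)
Definition constants (con : constraint) : seq nat :=
  match con with
  | SetSub _ _ | SetEq _ _ => [::]
  | NumEq l l' | NumLt l l' => paexpr_constants l ++ paexpr_constants l'
  | NumDiv n l => n :: paexpr_constants l
  end.

Definition no_transitive_role_in_numerical (T : tbox) : Prop :=
  forall con : constraint, List.In con (tbox_constraints T) -> numerical con ->
  forall r : nat, r \in constraint_roles con -> r \notin transitive_roles T.

Definition constants_zero_one (T : tbox) : Prop :=
  forall con : constraint, List.In con (tbox_constraints T) -> numerical con ->
  forall n : nat, n \in constants con -> n = 0 \/ n = 1.

(* Partial recursive functions, presented without arities: an argument vector  *)
(* is a list, and missing arguments of RSucc and RProj are read as 0.          *)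
Inductive recfun : Type :=
  | RZero
  | RSucc
  | RProj of nat
  | RComp of recfun & seq recfun
  | RPrec of recfun & recfun
  | RMu of recfun.

Inductive reval : recfun -> seq nat -> nat -> Prop :=
  | reval_zero v : reval RZero v 0
  | reval_succ v : reval RSucc v (head 0 v).+1
  | reval_proj i v : reval (RProj i) v (nth 0 v i)
  | reval_comp f gs v ws y :
      revals gs v ws -> reval f ws y -> reval (RComp f gs) v y
  | reval_prec0 f g v y : reval f v y -> reval (RPrec f g) (0 :: v) y
  | reval_precS f g n v z y :
      reval (RPrec f g) (n :: v) z -> reval g [:: n, z & v] y ->
      reval (RPrec f g) (n.+1 :: v) y
  | reval_mu f v n (w : nat -> nat) :
      (forall m, m < n -> reval f (m :: v) (w m).+1) ->
      reval f (n :: v) 0 -> reval (RMu f) v n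
with revals : seq recfun -> seq nat -> seq nat -> Prop :=
  | revals_nil v : revals [::] v [::]
  | revals_cons g gs v w ws :
      reval g v w -> revals gs v ws -> revals (g :: gs) v (w :: ws).

(* Goedel numbering: a constructor tag paired with the codes of the arguments. *)
Local Notation "<< x , y >>" := (Cantor.to_nat (x, y)).

Fixpoint concept_code (C : concept) : nat :=
  match C with
  | CName A => << 0, A >>
  | CNot D => << 1, concept_code D >>
  | CAnd D E => << 2, << concept_code D, concept_code E >> >>
  | CSucc con => << 3, constraint_code con >>
  end
with constraint_code (con : constraint) : nat :=
  match con with
  | SetSub s t => << 0, << sterm_code s, sterm_code t >> >>
  | SetEq s t => << 1, << sterm_code s, sterm_code t >> >>
  | NumEq l l' => << 2, << paexpr_code l, paexpr_code l' >> >>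
  | NumLt l l' => << 3, << paexpr_code l, paexpr_code l' >> >>
  | NumDiv n l => << 4, << n, paexpr_code l >> >>
  end
with sterm_code (s : sterm) : nat :=
  match s with
  | SRole r => << 0, r >>
  | SConcept C => << 1, concept_code C >>
  | SEmpty => << 2, 0 >>
  | SUniv => << 3, 0 >>
  | SInter t u => << 4, << sterm_code t, sterm_code u >> >>
  | SUnion t u => << 5, << sterm_code t, sterm_code u >> >>
  | SCompl t => << 6, sterm_code t >>
  end
with paexpr_code (l : paexpr) : nat :=
  match l with
  | PConst n => << 0, n >>
  | PAdd l' n s => << 1, << paexpr_code l', << n, sterm_code s >> >> >>
  end.

Definition axiom_code (ax : axiom) : nat :=
  match ax with
  | CI C D => << 0, << concept_code C, concept_code D >> >>
  | Trans r => << 1, r >>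
  end.

Fixpoint tbox_code (T : tbox) : nat :=
  match T with
  | [::] => 0
  | ax :: T' => << axiom_code ax, tbox_code T' >>.+1
  end.

Lemma code_pair_inj a b c d : << a, b >> = << c, d >> -> a = c /\ b = d.
Proof. by move=> /Cantor.to_nat_inj [-> ->]. Qed.

Ltac code_inj :=
  intros;
  repeat match goal with
  | H : Cantor.to_nat _ = Cantor.to_nat _ |- _ =>
      apply code_pair_inj in H; destruct H
  end;
  try discriminate; f_equal; auto.

Scheme concept_mind := Induction for concept Sort Prop
with constraint_mind := Induction for constraint Sort Prop
with sterm_mind := Induction for sterm Sort Prop
with paexpr_mind := Induction for paexpr Sort Prop.
Combined Scheme syntax_mind
  from concept_mind, constraint_mind, sterm_mind, paexpr_mind.

Lemma syntax_code_inj :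
  (forall C C', concept_code C = concept_code C' -> C = C') /\
  (forall con con', constraint_code con = constraint_code con' -> con = con') /\
  (forall s s', sterm_code s = sterm_code s' -> s = s') /\
  (forall l l', paexpr_code l = paexpr_code l' -> l = l').
Proof.
apply: syntax_mind; intros;
  match goal with |- _ = ?x => destruct x end;
  cbn [concept_code constraint_code sterm_code paexpr_code] in *; code_inj.
Qed.

Lemma tbox_code_inj : injective tbox_code.
Proof.
elim=> [|ax T IH] [|ax' T'] //= /succn_inj /code_pair_inj [eq_ax /IH ->].
congr cons; move: eq_ax.
by destruct ax, ax'; cbn [axiom_code]; code_inj; apply: (proj1 syntax_code_inj).
Qed.

(* The answer only matters on the instances in D.                              *)
Definition decidable_on (D P : tbox -> Prop) : Prop :=
  exists f : recfun, forall T : tbox, D T ->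
    (P T -> reval f [:: tbox_code T] 1) /\
    (~ P T -> reval f [:: tbox_code T] 0).

Definition undecidable_on (D P : tbox -> Prop) : Prop := ~ decidable_on D P.

(* Main.v *)
(* Given a hypothetical decider f, let g := f o s, where s n is the code of the
   TBox obtained by prepending the axiom "the input is n" to the TBox coded by n.
   A TBox Q_g states that the big-step evaluation of g on the input yields 0; fed
   with the code q of Q_g itself, g returns f's verdict on the TBox "input q" :: Q_g,
   which is consistent iff g returns 0 on q, that is, iff f declares it
   inconsistent.

   Elements of a model of Q_g are evaluation nodes, with registers and children,
   and list cells.  Evaluation needs agreements b(a(d)) = c(d) between functional
   roles.  These are enforced by a transitive role t that contains a at the sort X
   of d and b at the sort Y of a(d): if Z is the sort of b(a(d)), the constraint
   "t intersected with Z is included in c" at d says that b(a(d)) = c(d).  As X, Y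
   and Z are pairwise distinct, t can be chosen to have no longer chains.  To keep
   them distinct, children of nodes and tails and heads of cells change colour, and
   each register comes in one copy per colour.  Numerical constraints are only used
   to make roles functional. *)

From HB Require Import structures.
From mathcomp Require Import all_boot finmap zify.
From mathcomp Require Import boolp classical_sets functions cardinality.
From Stdlib Require Cantor.
Require Import Defs.

Set Implicit Arguments.
Unset Strict Implicit.
Unset Printing Implicit Defensive.

Local Open Scope classical_set_scope.

(** * Total recursive functions *)

Definition recursive (F : seq nat -> nat) : Prop :=
  exists f, forall v, reval f v (F v).

Lemma recursive_proj i : recursive (nth 0 ^~ i).
Proof. by exists (RProj i) => v; constructor. Qed.

Lemma recursive_comp1 F G :
  recursive F -> recursive G -> recursive (fun v => F [:: G v]).
Proof.
move=> [f fP] [g gP]; exists (RComp f [:: g]) => v.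
by apply: (reval_comp _ (fP [:: _])); do 2! [constructor => //].
Qed.

Lemma recursive_comp2 F G H : recursive F -> recursive G -> recursive H ->
  recursive (fun v => F [:: G v; H v]).
Proof.
move=> [f fP] [g gP] [h hP]; exists (RComp f [:: g; h]) => v.
by apply: (reval_comp _ (fP [:: _; _])); do 3! [constructor => //].
Qed.

Lemma recursive_succ F : recursive F -> recursive (fun v => (F v).+1).
Proof.
move=> rF; apply: (recursive_comp1 (F := fun v => (head 0 v).+1)) rF.
by exists RSucc => v; constructor.
Qed.

Lemma recursive_const n : recursive (fun=> n).
Proof.
elim: n => [|n IH]; last exact: recursive_succ.
by exists RZero => v; constructor.
Qed.

Lemma recursive_rec (G : seq nat -> nat) (a : nat -> nat) (h : nat -> nat -> nat) F :
  recursive (fun v => a (nth 0 v 0)) ->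
  recursive (fun v => h (nth 0 v 0) (nth 0 v 1)) ->
  recursive F -> recursive G ->
  recursive (fun v => nat_rec _ (a (G v)) h (F v)).
Proof.
move=> [fa aP] [fh hP] rF rG.
apply: (recursive_comp2
  (F := fun v => nat_rec _ (a (nth 0 v 1)) h (nth 0 v 0)) _ rF rG).
exists (RComp (RPrec fa fh) [:: RProj 0; RProj 1]) => v.
apply: (reval_comp (ws := [:: nth 0 v 0; nth 0 v 1])); first by do 3! [constructor].
elim: (nth 0 v 0) => [|n IH] /=; first by constructor; apply: (aP [:: _]).
exact: reval_precS IH (hP [:: _; _; _]).
Qed.

Lemma recursive_add F G :
  recursive F -> recursive G -> recursive (fun v => F v + G v).
Proof.
move=> rF rG.
have -> : (fun v => F v + G v) = (fun v => nat_rec _ (G v) (fun=> succn) (F v)).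
  by apply/funext => v; elim: (F v) => // n; rewrite addSn => ->.
apply: (recursive_rec (a := id)) => //; first exact: recursive_proj.
exact/recursive_succ/recursive_proj.
Qed.

Lemma recursive_pair F G : recursive F -> recursive G ->
  recursive (fun v => Cantor.to_nat (F v, G v)).
Proof.
(* [Cantor.to_nat (x, y)] is [y] plus the triangular number of [y + x]; the latter is the recursion
   with step [i.+1 + m]. *)
move=> rF rG; rewrite /Cantor.to_nat.
apply: (recursive_add rG).
apply: (recursive_rec (a := fun=> 0) (h := fun i m => i.+1 + m) (G := fun=> 0)).
- exact: recursive_const.
- by apply: recursive_add; [apply: recursive_succ|]; apply: recursive_proj.
- exact: recursive_add.
- exact: recursive_const.
Qed.

(** * Subprograms and their names *)

(* [CV gs] stands for the evaluation of the components of gs, and [CM f] for the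
   search of a zero of f upwards from the head of the argument list. *)
Inductive code := CF of recfun | CV of seq recfun | CM of recfun.

Fixpoint recfun_tree (f : recfun) : GenTree.tree nat :=
  match f with
  | RZero => GenTree.Leaf 0
  | RSucc => GenTree.Leaf 1
  | RProj i => GenTree.Leaf i.+2
  | RComp f gs => GenTree.Node 0 (recfun_tree f :: map recfun_tree gs)
  | RPrec f g => GenTree.Node 1 [:: recfun_tree f; recfun_tree g]
  | RMu f => GenTree.Node 2 [:: recfun_tree f]
  end.

(** The components of [RComp] form a list of programs, so the structural recursion on programs
    contains an induction on that list. *)
Lemma recfun_tree_inj : injective recfun_tree.
Proof.
rewrite /injective; fix IH 1; case=> [||i|f gs|f g|f] [||i'|f' gs'|f' g'|f'] //=.
- by case=> ->.
- case=> /IH -> eq_gs; congr RComp.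
  elim: gs gs' eq_gs => [|g gs IHgs] [|g' gs'] //= [] /IH ->.
  by move/IHgs ->.
- by case=> /IH -> /IH ->.
- by case=> /IH ->.
Qed.

Fact code_num_ex : exists num : code -> nat, injective num.
Proof.
exists (fun c => match c with
  | CF f => choice.pickle (0, [:: recfun_tree f])
  | CV gs => choice.pickle (1, map recfun_tree gs)
  | CM f => choice.pickle (2, [:: recfun_tree f])
  end).
have inj := pcan_inj (@choice.pickleK (nat * seq (GenTree.tree nat))%type).
case=> [f|gs|f] [f'|gs'|f'] /inj // [].
- by move/recfun_tree_inj ->.
- by move/(inj_map recfun_tree_inj) ->.
- by move/recfun_tree_inj ->.
Qed.

(* Sealed behind choice, so that conversion never unfolds the encoding. *)
Definition code_num : code -> nat := projT1 (cid code_num_ex).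

Lemma code_num_inj : injective code_num.
Proof. exact: projT2 (cid code_num_ex). Qed.

(** Closed under the calls made by evaluation: a projection calls those of smaller index, and a list
    of components calls its suffixes. The inner [fix] is a copy of [subcodesv], inlined for the sake
    of structural recursion. *)
Fixpoint subcodes (f : recfun) : seq code :=
  CF f :: match f with
  | RZero | RSucc => [::]
  | RProj i => [seq CF (RProj j) | j <- iota 0 i]
  | RComp f gs =>
      (fix subcodesv gs :=
         CV gs :: if gs is g :: gs' then subcodes g ++ subcodesv gs' else [::])
        gs ++ subcodes f
  | RPrec f g => subcodes f ++ subcodes g
  | RMu f => CM f :: subcodes f
  end.

Fixpoint subcodesv (gs : seq recfun) : seq code :=
  CV gs :: if gs is g :: gs' then subcodes g ++ subcodesv gs' else [::].

Scheme reval_min := Minimality for reval Sort Prop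
with revals_min := Minimality for revals Sort Prop.
Combined Scheme reval_revals_ind from reval_min, revals_min.

(** * The TBox of a program *)

Notation reg := 'I_9.

(** These roles are total functions on all elements. [Root] leads from an arbitrary element to a
    node that starts the evaluation, and the Boolean of [Reg] is the colour of the copy. *)
Inductive frole := Hd | Tl | Root | Ch of bool | Reg of reg & bool.

Definition frole_enc (r : frole) : bool + (bool + option (reg * bool)) :=
  match r with
  | Hd => inl true
  | Tl => inl false
  | Root => inr (inr None)
  | Ch a => inr (inl a)
  | Reg x j => inr (inr (Some (x, j)))
  end.

Definition frole_dec (e : bool + (bool + option (reg * bool))) : frole :=
  match e with
  | inl b => if b then Hd else Tl
  | inr (inr None) => Root
  | inr (inl a) => Ch a
  | inr (inr (Some (x, j))) => Reg x j
  end.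

Lemma frole_encK : cancel frole_enc frole_dec.
Proof. by case. Qed.

HB.instance Definition _ := Finite.copy frole (can_type frole_encK).

Notation role := (frole + frole * frole * bool)%type.

Fact role_num_ex : exists num : role -> nat, injective num.
Proof. by exists choice.pickle; apply: pcan_inj choice.pickleK. Qed.

Definition role_num : role -> nat := projT1 (cid role_num_ex).

Lemma role_num_inj : injective role_num.
Proof. exact: projT2 (cid role_num_ex). Qed.

Definition SFun (r : frole) : sterm := SRole (role_num (inl r)).

(* The transitive role of (a, b, k) simulates the composition of the functional
   roles a and b at nodes of colour k. *)
Definition comp_num (a b : frole) (k : bool) : nat := role_num (inr (a, b, k)).

(* A sort (n, k) says whether an element is a node (and not a cell), and its colour. *)
Definition target (r : frole) (s : bool * bool) : bool * bool :=
  match r with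
  | Hd | Tl | Ch _ => (s.1, ~~ s.2)
  | Root => (true, false)
  | Reg _ j => (false, j)
  end.

Notation NodeName := 0.
Notation ColourName := 1.
Notation NilName := 2.
Notation InitName := 3.
Notation class_name c := (code_num c).+4.

Definition CTop : concept := CSucc (SetEq SEmpty SEmpty).
Definition CLit (b : bool) (A : nat) : concept :=
  if b then CName A else CNot (CName A).
Definition CSort (s : bool * bool) : concept :=
  CAnd (CLit s.1 NodeName) (CLit s.2 ColourName).
Definition CAll (r : frole) (C : concept) : concept :=
  CSucc (SetSub (SFun r) (SConcept C)).
Definition CFunct (r : frole) : concept :=
  CSucc (NumEq (PAdd (PConst 0) 1 (SFun r)) (PConst 1)).
Definition CIncl (a b : frole) (k : bool) (r : frole) : concept :=
  CSucc (SetSub (SFun r) (SRole (comp_num a b k))).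
Definition CAgree (a b : frole) (k : bool) (c : frole) : concept :=
  CSucc (SetSub
    (SInter (SRole (comp_num a b k))
            (SConcept (CSort (target b (target a (true, k))))))
    (SFun c)).

Definition functional_axioms (r : frole) : tbox :=
  CI CTop (CFunct r) ::
  [seq CI (CSort s) (CAll r (CSort (target r s))) | s <- enum {: bool * bool}].

Definition composable (a b : frole) (k : bool) : bool :=
  let s := (true, k) in uniq [:: s; target a s; target b (target a s)].

Definition composition_axioms (p : frole * frole * bool) : tbox :=
  let: (a, b, k) := p in
  if composable a b k then
    [:: Trans (comp_num a b k);
        CI (CSort (true, k)) (CIncl a b k a);
        CI (CSort (target a (true, k))) (CIncl a b k b)]
  else [::].

(** * Evaluation rules as agreements between registers *)

Notation "'%r' n" := (@Ordinal 9 n isT) (at level 0).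
Notation rarg := (%r 0).
Notation rres := (%r 1).

(* Registers hold lists of numbers, a number n being the list [nseq n 0].
   [Call a c x y]: child a is a node of class c whose argument and result are
   the contents of x and y. *)
Inductive atom :=
  | Call of bool & code & reg & reg
  | IsHd of reg & reg
  | IsTl of reg & reg
  | IsNil of bool & reg.

Definition guard := option (bool * reg).
Definition rule := (guard * atom)%type.

Definition always : atom -> rule := pair None.
Definition whenNil (x : reg) : atom -> rule := pair (Some (true, x)).
Definition whenCons (x : reg) : atom -> rule := pair (Some (false, x)).
Definition IsCons (x y z : reg) : seq atom :=
  [:: IsNil false x; IsHd x y; IsTl x z].

(** As 0 is the empty list, [IsNil] tests for zero, [IsTl] takes predecessors, and a cons with an
    empty head is a successor. For [RPrec] on [n.+1 :: v], registers 2 to 8 hold [n.+1], [v], [n],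
    [n :: v], the previous value [z], [[:: n, z & v]] and [z :: v]. For [CM], register 6 holds the
    value of [f] at the current candidate, and register 4 the next candidate. *)
Definition rules (c : code) : seq rule :=
  match c with
  | CF RZero => [:: always (IsNil true rres)]
  | CF RSucc =>
      map always (IsCons rres (%r 4) (%r 2) ++
                  [:: IsNil true (%r 4); IsHd rarg (%r 2)])
  | CF (RProj 0) => [:: always (IsHd rarg rres)]
  | CF (RProj i.+1) =>
      map always [:: IsTl rarg (%r 3); Call false (CF (RProj i)) (%r 3) rres]
  | CF (RComp f gs) =>
      map always [:: Call false (CV gs) rarg (%r 5); Call true (CF f) (%r 5) rres]
  | CF (RPrec f g) =>
      map always [:: IsHd rarg (%r 2); IsTl rarg (%r 3)] ++
      [:: whenNil (%r 2) (Call false (CF f) (%r 3) rres)] ++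
      map (whenCons (%r 2))
        (IsTl (%r 2) (%r 4) :: IsCons (%r 5) (%r 4) (%r 3) ++
         Call false (CF (RPrec f g)) (%r 5) (%r 6) ::
         IsCons (%r 7) (%r 4) (%r 8) ++ IsCons (%r 8) (%r 6) (%r 3) ++
         [:: Call true (CF g) (%r 7) rres])
  | CF (RMu f) =>
      map always (IsCons (%r 5) (%r 2) rarg ++
                  [:: IsNil true (%r 2); Call false (CM f) (%r 5) rres])
  | CV [::] => [:: always (IsNil true rres)]
  | CV (g :: gs) =>
      map always (IsCons rres (%r 2) (%r 3) ++
                  [:: Call false (CF g) rarg (%r 2); Call true (CV gs) rarg (%r 3)])
  | CM f =>
      map always [:: Call false (CF f) rarg (%r 6); IsHd rarg (%r 2); IsTl rarg (%r 3)] ++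
      [:: whenNil (%r 6) (IsHd rarg rres)] ++
      map (whenCons (%r 6))
        (IsCons (%r 5) (%r 4) (%r 3) ++ IsCons (%r 4) (%r 7) (%r 2) ++
         [:: IsNil true (%r 7); Call true (CM f) (%r 5) rres])
  end.

(** Both copies of a register are meant to represent the same list, so the test of one copy
    suffices. *)
Definition CGuard (g : guard) : concept :=
  if g is Some (b, x) then CAll (Reg x false) (CLit b NilName) else CTop.

Definition agree_axioms (X : concept) (a b c : frole) : tbox :=
  [seq CI (CAnd X (CSort (true, k))) (CAgree a b k c) | k <- enum {: bool}].

Definition atom_axioms (X : concept) (t : atom) : tbox :=
  match t with
  | Call a c x y =>
      CI X (CAll (Ch a) (CName (class_name c))) ::
      List.flat_map (fun j =>
        agree_axioms X (Ch a) (Reg rarg j) (Reg x j) ++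
        agree_axioms X (Ch a) (Reg rres j) (Reg y j)) (enum {: bool})
  | IsHd x y =>
      List.flat_map (fun j => agree_axioms X (Reg x j) Hd (Reg y (~~ j)))
        (enum {: bool})
  | IsTl x y =>
      List.flat_map (fun j => agree_axioms X (Reg x j) Tl (Reg y (~~ j)))
        (enum {: bool})
  | IsNil b x => [seq CI X (CAll (Reg x j) (CLit b NilName)) | j <- enum {: bool}]
  end.

Definition rule_axioms (c : code) (r : rule) : tbox :=
  atom_axioms (CAnd (CName (class_name c)) (CGuard r.1)) r.2.

Definition code_axioms (c : code) : tbox :=
  CI (CName (class_name c)) (CName NodeName) ::
  List.flat_map (rule_axioms c) (rules c).

Definition frame_axioms : tbox :=
  List.flat_map functional_axioms (enum {: frole}) ++
  List.flat_map composition_axioms (enum {: frole * frole * bool}) ++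
  [:: CI (CName NilName) (CAll Hd (CName NilName));
      CI (CName NilName) (CAll Tl (CName NilName))].

(** The empty result register asserts that the evaluation yields 0; any other value contradicts
    these axioms. *)
Definition root_axioms (g : recfun) : tbox :=
  CI CTop (CAll Root (CName (class_name (CF g)))) ::
  [seq CI CTop (CAll Root (CAnd (CAll (Reg rarg j) (CName InitName))
                               (CAll (Reg rres j) (CName NilName)))) | j <- enum {: bool}].

(** The argument list has one entry, whose value is left open. Hence this TBox and its code are
    fixed before the input is chosen, as the diagonal argument requires. *)
Definition program_tbox (g : recfun) : tbox :=
  CI (CName InitName) (CAnd (CNot (CName NilName)) (CAll Tl (CName NilName))) ::
  root_axioms g ++ frame_axioms ++ List.flat_map code_axioms (subcodes g).

Fixpoint CNum (n : nat) : concept :=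
  if n is n'.+1 then
    CAnd (CAnd (CNot (CName NilName)) (CAll Hd (CName NilName)))
         (CAll Tl (CNum n'))
  else CName NilName.

Definition init_axiom (n : nat) : axiom :=
  CI (CName InitName) (CAll Hd (CNum n)).

Definition input_tbox (g : recfun) (n : nat) : tbox :=
  init_axiom n :: program_tbox g.

(** * Models of composed TBoxes *)

Lemma in_List (T : eqType) (x : T) (s : seq T) : x \in s -> List.In x s.
Proof.
by elim: s => //= y s IH; rewrite in_cons => /orP[/eqP ->|/IH]; [left|right].
Qed.

Lemma model_cons I ax T : model I (ax :: T) <-> satisfies I ax /\ model I T.
Proof.
split=> [IT|[Iax IT] ax' /= [<-|/IT]] //.
by split=> [|ax' T_ax']; apply: IT; [left | right].
Qed.

Lemma model_cat I T U : model I (T ++ U) <-> model I T /\ model I U.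
Proof.
split=> [ITU|[IT IU] ax /List.in_app_iff[/IT|/IU]] //.
by split=> ax ax_in; apply/ITU/List.in_app_iff; [left | right].
Qed.

Lemma model_flat_map I (X : Type) (F : X -> tbox) s :
  model I (List.flat_map F s) <-> forall x, List.In x s -> model I (F x).
Proof.
split=> [IF x s_x ax ax_in|IF ax /List.in_flat_map[x [/IF]]]; last exact.
by apply/IF/List.in_flat_map; exists x.
Qed.

Lemma model_flat_map_enum I (X : finType) (F : X -> tbox) :
  model I (List.flat_map F (enum X)) <-> forall x, model I (F x).
Proof.
rewrite model_flat_map; split=> IF x; last by move=> _.
by apply: IF; apply: in_List; rewrite mem_enum.
Qed.

Lemma model_map_enum I (X : finType) (F : X -> axiom) :
  model I [seq F x | x <- enum X] <-> forall x, satisfies I (F x).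
Proof.
have -> : [seq F x | x <- enum X] = List.flat_map (fun x => [:: F x]) (enum X).
  by elim: (enum X) => //= x s ->.
rewrite model_flat_map_enum; split=> IF x; last by apply/model_cons; split=> // ? [].
by have /model_cons[] := IF x.
Qed.

(** * Soundness: models compute *)

Section Soundness.

Variables (I : interp) (g : recfun).
Hypothesis I_fin : finitely_branching I.
Hypothesis I_model : model I (program_tbox g).

Local Notation ext := (concept_ext I).

Lemma sub_ars n (d : dom I) : role_int n d `<=` ars d.
Proof. by move=> e; exists n. Qed.

Lemma frame_model : model I frame_axioms.
Proof. by case/model_cons: I_model => _ /model_cat[_ /model_cat[]]. Qed.

Lemma functional_ex r (d : dom I) : exists e, role_int (role_num (inl r)) d = [set e].
Proof.
case/model_cat: frame_model => /model_flat_map_enum/(_ r)/model_cons[+ _] _.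
move=> /(_ d erefl); rewrite /= add0n mul1n => /eqP/cardfs1P[e eq_e].
(* Finite branching makes [fset_set] faithful, so cardinality 1 really means a singleton. *)
exists e; rewrite -(@fset_setK _ (role_int _ d)) ?eq_e.
  by apply/seteqP; split=> x /=; rewrite in_fset1 => /eqP.
exact: sub_finite_set (@sub_ars _ _) (I_fin d).
Qed.

Definition fn (r : frole) (d : dom I) : dom I := projT1 (cid (functional_ex r d)).

Lemma fnE r d : role_int (role_num (inl r)) d = [set fn r d].
Proof. by rewrite /fn; case: cid. Qed.

Lemma ext_all r C d : ext (CAll r C) d -> ext C (fn r d).
Proof. by move=> /(_ (fn r d)) /=; rewrite fnE => -[]. Qed.

Lemma ext_allE r C d : ext (CAll r C) d <-> ext C (fn r d).
Proof.
split; first exact: ext_all.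
move=> Cd e /=; rewrite fnE => ->; split=> //.
by apply: (@sub_ars (role_num (inl r))); rewrite fnE.
Qed.

Lemma ext_sort r s d : ext (CSort s) d -> ext (CSort (target r s)) (fn r d).
Proof.
case/model_cat: frame_model => /model_flat_map_enum/(_ r)/model_cons[_] + _.
by move=> /model_map_enum/(_ s) + sd => /(_ d sd)/ext_all.
Qed.

Lemma ext_node d : ext (CName NodeName) d -> exists k, ext (CSort (true, k)) d.
Proof.
move=> d_node; have [dC|dC] := pselect (ext (CName ColourName) d).
  by exists true.
by exists false.
Qed.

Lemma ext_agree a b k c d : composable a b k ->
  ext (CSort (true, k)) d -> ext (CAgree a b k c) d -> fn b (fn a d) = fn c d.
Proof.
move=> abk dk; case/model_cat: frame_model => _ /model_cat[+ _].
move=> /model_flat_map_enum/(_ (a, b, k)); rewrite /= abk.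
move=> /model_cons[tr /model_cons[ax_a /model_cons[ax_b _]]].
have sa := ext_sort a dk; have sb := ext_sort b sa.
have := ax_a d dk; rewrite /= fnE => /(_ _ erefl) ta.
have := ax_b _ sa; rewrite /= fnE => /(_ _ erefl) tb.
have tab := tr _ _ _ ta tb.
rewrite /= fnE => /(_ (fn b (fn a d))); apply; split=> //; split=> //.
exact: sub_ars tab.
Qed.

(** * Lists represented by elements *)

Local Notation nil e := (concept_ext I (CName NilName) e).

Fixpoint repn (n : nat) (e : dom I) : Prop :=
  if n is n'.+1 then ~ nil e /\ nil (fn Hd e) /\ repn n' (fn Tl e) else nil e.

(** A relation and not a function of [e]: the tails of an element may never reach [NilName], and
    then it represents no list. *)
Fixpoint repl (v : seq nat) (e : dom I) : Prop :=
  if v is n :: v' then ~ nil e /\ repn n (fn Hd e) /\ repl v' (fn Tl e)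
  else nil e.

Lemma repl_nseq n e : repl (nseq n 0) e <-> repn n e.
Proof. by elim: n e => //= n IH e; rewrite IH. Qed.

Lemma repl_nil v e : repl v e -> nil e <-> v = [::].
Proof. by case: v => //= n v [nil_e _]; split. Qed.

(** This matches the defaults [head 0 [::] = 0] and [behead [::] = [::]], by which missing arguments
    are read as 0. *)
Lemma nil_hd_tl e : nil e -> nil (fn Hd e) /\ nil (fn Tl e).
Proof.
case/model_cat: frame_model => _ /model_cat[_].
by move=> /model_cons[H /model_cons[H' _]] nil_e; split; apply: ext_all; auto.
Qed.

Lemma repl_hd v e : repl v e -> repl (nseq (head 0 v) 0) (fn Hd e).
Proof. by case: v => [/nil_hd_tl[]|n v /= [_ []]] //; rewrite repl_nseq. Qed.

Lemma repl_tl v e : repl v e -> repl (behead v) (fn Tl e).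
Proof. by case: v => [/nil_hd_tl[]|n v /= [_ []]]. Qed.

Definition holds_list (x : reg) (v : seq nat) (d : dom I) : Prop :=
  forall j, repl v (fn (Reg x j) d).

Definition atom_holds (t : atom) (d : dom I) : Prop :=
  match t with
  | Call a c x y => [/\ ext (CName (class_name c)) (fn (Ch a) d),
      forall j, fn (Reg rarg j) (fn (Ch a) d) = fn (Reg x j) d &
      forall j, fn (Reg rres j) (fn (Ch a) d) = fn (Reg y j) d]
  | IsHd x y => forall j, fn Hd (fn (Reg x j) d) = fn (Reg y (~~ j)) d
  | IsTl x y => forall j, fn Tl (fn (Reg x j) d) = fn (Reg y (~~ j)) d
  | IsNil b x => forall j, nil (fn (Reg x j) d) <-> b
  end.

Lemma ext_lit b n d : ext (CLit b n) d <-> (ext (CName n) d <-> b).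
Proof. by case: b; split=> //= -[H1 H2]; auto => /H1. Qed.

Lemma agree_model X a b c d : (forall k, composable a b k) ->
  ext X d -> ext (CName NodeName) d -> model I (agree_axioms X a b c) ->
  fn b (fn a d) = fn c d.
Proof.
move=> abk Xd /ext_node[k dk] /model_map_enum/(_ k) H.
by apply: (ext_agree (abk k)) (H _ _) => //; split.
Qed.

(** All compositions used by atoms are composable at every colour: a child has the opposite colour
    of its parent, a register leads from a node to a cell, and [Hd] and [Tl] flip the colour of the
    cell. *)
Lemma atom_model X t d : ext X d -> ext (CName NodeName) d ->
  model I (atom_axioms X t) -> atom_holds t d.
Proof.
move=> Xd node_d; case: t => [a c x y|x y|x y|b x] /=.
- case/model_cons=> call /model_flat_map_enum agr.
  split=> [|j|j]; first exact: (@ext_all _ (CName _) d (call d Xd)).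
    have /model_cat[+ _] := agr j; apply: agree_model => //.
    by case: j {agr} => -[].
  have /model_cat[_] := agr j; apply: agree_model => //.
  by case: j {agr} => -[].
- move=> /model_flat_map_enum agr j; apply: agree_model (agr j) => //.
  by case: j => -[].
- move=> /model_flat_map_enum agr j; apply: agree_model (agr j) => //.
  by case: j => -[].
- by move=> /model_map_enum H j; apply/ext_lit/ext_all/H.
Qed.

Definition rule_holds (c : code) (r : rule) : Prop :=
  forall d, ext (CName (class_name c)) d ->
    (if r.1 is Some (b, x) then nil (fn (Reg x false) d) <-> b else True) ->
    atom_holds r.2 d.

Lemma rules_hold c r :
  List.In c (subcodes g) -> List.In r (rules c) -> rule_holds c r.
Proof.
move=> gc cr d cd guard_d; case/model_cons: I_model => _.
case/model_cat=> _ /model_cat[_ /model_flat_map/(_ c gc)].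
case/model_cons=> node /model_flat_map/(_ r cr).
apply: atom_model; last exact: node.
split=> //; case: r.1 guard_d => [[b x]|//].
by move=> H; apply/ext_allE/ext_lit.
Qed.

Definition evaluates (c : code) (v w : seq nat) : Prop :=
  forall d, ext (CName (class_name c)) d -> holds_list rarg v d ->
    holds_list rres w d.

Section Rules.

Variables (c : code) (d : dom I).
Hypothesis cd : ext (CName (class_name c)) d.

Definition active (t : atom) : Prop := atom_holds t d.

Lemma whenNil_active x t :
  rule_holds c (whenNil x t) -> holds_list x [::] d -> active t.
Proof. by move=> H xd; apply: H => //=; have /= := xd false. Qed.

Lemma whenCons_active x n v t :
  rule_holds c (whenCons x t) -> holds_list x (n :: v) d -> active t.
Proof. by move=> H xd; apply: H => //=; split=> // ?; case: (xd false). Qed.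

Lemma active_call a c' x y v w :
  active (Call a c' x y) -> evaluates c' v w -> holds_list x v d ->
  holds_list y w d.
Proof.
by move=> [c'd xE yE] ev xd j; rewrite -yE; apply: ev => // i; rewrite xE.
Qed.

Lemma active_hd x y v :
  active (IsHd x y) -> holds_list x v d -> holds_list y (nseq (head 0 v) 0) d.
(* Copy [j] of [y] is the head of copy [~~ j] of [x]. *)
Proof. by move=> xy xd j; rewrite -[j]negbK -xy; apply: repl_hd. Qed.

Lemma active_tl x y v :
  active (IsTl x y) -> holds_list x v d -> holds_list y (behead v) d.
Proof. by move=> xy xd j; rewrite -[j]negbK -xy; apply: repl_tl. Qed.

Lemma active_nil x : active (IsNil true x) -> holds_list x [::] d.
Proof. by move=> nx j; apply/nx. Qed.

Lemma active_cons x y z n v :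
  active (IsNil false x) -> active (IsHd x y) -> active (IsTl x z) ->
  holds_list y (nseq n 0) d -> holds_list z v d -> holds_list x (n :: v) d.
Proof.
move=> nx xy xz yd zd j; split; first by move/nx.
by rewrite -repl_nseq xy xz.
Qed.

End Rules.

Lemma rules_hold_all c : List.In c (subcodes g) ->
  foldr (fun r P => rule_holds c r /\ P) True (rules c).
Proof.
move=> /rules_hold; elim: (rules c) => //= r rs IH H.
by split; [apply: H; left | apply: IH => r' r'_in; apply: H; right].
Qed.

Lemma proj_evaluates i v : (forall j, j <= i -> List.In (CF (RProj j)) (subcodes g)) ->
  evaluates (CF (RProj i)) v (nseq (nth 0 v i) 0).
Proof.
elim: i v => [|i IH] v sub d cd argd.
  have [h _] := rules_hold_all (sub 0 (leqnn _)).
  by rewrite nth0; apply: active_hd (h d cd _) argd.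
have [h1 [h2 _]] := rules_hold_all (sub _ (leqnn _)).
have := active_call (h2 d cd _) (IH (behead v) _).
rewrite nth_behead; apply=> // [j ji|]; first by apply/sub/leqW.
exact: active_tl (h1 d cd _) argd.
Qed.

(** Induction on the distance [k] to the zero [n]. At distance 0 the value of [f] is empty and the
    candidate is returned; before that the value is a successor, so the search calls itself on the
    next candidate. *)
Lemma min_evaluates f v n (w : nat -> nat) : List.In (CM f) (subcodes g) ->
  (forall m, m < n -> evaluates (CF f) (m :: v) (nseq (w m).+1 0)) ->
  evaluates (CF f) (n :: v) [::] ->
  forall k, k <= n -> evaluates (CM f) (n - k :: v) (nseq n 0).
Proof.
move=> sub ev_pos ev_zero.
have /= [h1 [h2 [h3 [h4 [h5 [h6 [h7 [h8 [h9 [h10 [h11 [h12 _]]]]]]]]]]]] :=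
  rules_hold_all sub.
elim=> [|k IH] kn d cd argd.
  have z := active_call (h1 d cd _) ev_zero; rewrite subn0 in argd.
  exact: active_hd (whenNil_active cd h4 (z Logic.I argd)) argd.
have lt_n : n - k.+1 < n by lia.
have z := active_call (h1 d cd Logic.I) (ev_pos _ lt_n) argd.
have act t H := @whenCons_active _ _ cd _ _ _ t H z.
apply: (active_call (act _ h12) (IH (ltnW kn))).
have hd := active_hd (h2 d cd Logic.I) argd.
have tl := active_tl (h3 d cd Logic.I) argd.
apply: (active_cons (act _ h5) (act _ h6) (act _ h7)) => //.
have -> : n - k = (n - k.+1).+1 by lia.
apply: (active_cons (act _ h8) (act _ h9) (act _ h10)) => //.
exact: active_nil (act _ h11).
Qed.

(** The induction is on the derivation, as no axiom makes the calls in a model well founded. Each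
    big-step rule is replayed by the registers and children of an arbitrary node of the class. *)
Lemma code_evaluates :
  (forall f v y, reval f v y ->
    (forall c, List.In c (subcodes f) -> List.In c (subcodes g)) ->
    evaluates (CF f) v (nseq y 0)) /\
  (forall gs v w, revals gs v w ->
    (forall c, List.In c (subcodesv gs) -> List.In c (subcodes g)) ->
    evaluates (CV gs) v w).
Proof.
apply: reval_revals_ind.
- move=> v /(_ _ (or_introl erefl)) /rules_hold_all/= [h _] d cd _.
  exact: active_nil (h d cd _).
- move=> v /(_ _ (or_introl erefl)) /rules_hold_all/=.
  move=> [h1 [h2 [h3 [h4 [h5 _]]]]] d cd argd.
  apply: (active_cons (h1 d cd _) (h2 d cd _) (h3 d cd _)) => //.
    exact: active_nil (h4 d cd _).
  exact: active_hd (h5 d cd _) argd.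
- move=> i v sub; apply: proj_evaluates => j; rewrite leq_eqVlt.
  case/orP=> [/eqP ->|ji]; apply: sub; first by left.
  right; apply/List.in_map/in_List; rewrite mem_iota; lia.
- move=> f gs v ws y _ IHgs _ IHf sub d cd argd.
  have /= [h1 [h2 _]] := rules_hold_all (sub _ (or_introl erefl)).
  apply: (active_call (h2 d cd _) (IHf _)) => //.
    by move=> c fc; apply: sub; right; apply/List.in_app_iff; right.
  apply: (active_call (h1 d cd _) (IHgs _)) => //.
  by move=> c fc; apply: sub; right; apply/List.in_app_iff; left.
- move=> f f' v y _ IHf sub d cd argd.
  have /= [h1 [h2 [h3 _]]] := rules_hold_all (sub _ (or_introl erefl)).
  have hd := active_hd (h1 d cd Logic.I) argd.
  have tl := active_tl (h2 d cd Logic.I) argd.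
  apply: (active_call (whenNil_active cd h3 hd) (IHf _)) => //.
  by move=> c fc; apply: sub; right; apply/List.in_app_iff; left.
- move=> f f' n v z y _ IHz _ IHf' sub d cd argd.
  have /= [h1 [h2 [_ [h4 [h5 [h6 [h7 [h8 [h9 [h10 [h11 [h12 [h13 [h14 [h15 _]]]]]]]]]]]]]]] :=
    rules_hold_all (sub _ (or_introl erefl)).
  have hd := active_hd (h1 d cd Logic.I) argd.
  have tl := active_tl (h2 d cd Logic.I) argd.
  have act t H := @whenCons_active _ _ cd _ _ _ t H hd.
  have pr := active_tl (act _ h4) hd.
  apply: (active_call (act _ h15) (IHf' _)) => //.
    by move=> c fc; apply: sub; right; apply/List.in_app_iff; right.
  apply: (active_cons (act _ h9) (act _ h10) (act _ h11)) => //.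
  apply: (active_cons (act _ h12) (act _ h13) (act _ h14)) => //.
  apply: (active_call (act _ h8) (IHz sub)).
  exact: (active_cons (act _ h5) (act _ h6) (act _ h7)).
- move=> f v n w _ IHpos _ IHzero sub d cd argd.
  have /= [h1 [h2 [h3 [h4 [h5 _]]]]] := rules_hold_all (sub _ (or_introl erefl)).
  have sub_f c : List.In c (subcodes f) -> List.In c (subcodes g).
    by move=> fc; apply: sub; right; right.
  (* The search starts at 0, which is the distance [k = n]. *)
  have ev : evaluates (CM f) (n - n :: v) (nseq n 0).
    apply: (@min_evaluates _ _ _ w) => [|m mn||]; first by apply: sub; right; left.
    + exact: IHpos.
    + exact: IHzero.
    + exact: leqnn.
  rewrite subnn in ev; apply: (active_call (h5 d cd _) ev) => //.
  apply: (active_cons (h1 d cd _) (h2 d cd _) (h3 d cd _)) => //.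
  exact: active_nil (h4 d cd _).
- move=> v /(_ _ (or_introl erefl)) /rules_hold_all/= [h _] d cd _.
  exact: active_nil (h d cd _).
- move=> f gs v y ws _ IHf _ IHgs sub d cd argd.
  have /= [h1 [h2 [h3 [h4 [h5 _]]]]] := rules_hold_all (sub _ (or_introl erefl)).
  apply: (active_cons (h1 d cd _) (h2 d cd _) (h3 d cd _)) => //.
    apply: (active_call (h4 d cd _) (IHf _)) => //.
    by move=> c fc; apply: sub; right; apply/List.in_app_iff; left.
  apply: (active_call (h5 d cd _) (IHgs _)) => //.
  by move=> c fc; apply: sub; right; apply/List.in_app_iff; right.
Qed.

Lemma ext_num n e : ext (CNum n) e <-> repn n e.
Proof.
elim: n e => [|n IH] e //; split.
  move=> [[e_nil hd_nil] tl]; split=> //; split; last exact/IH/ext_all.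
  exact: (@ext_all Hd (CName _)).
move=> [e_nil [hd_nil /IH tl]]; split; last exact/ext_allE.
by split=> //; apply/(ext_allE Hd (CName _)).
Qed.

(** The argument register of a root node represents [[:: n]], so its result register represents [y];
    but the root axioms make that register empty. *)
Lemma input_sound n y : satisfies I (init_axiom n) -> reval g [:: n] y -> y = 0.
Proof.
move=> init gy; case/model_cons: I_model => init' /model_cat[root _].
(* Every element has a [Root] successor, so any element of the domain will do. *)
case/model_cons: root => /(_ point erefl)/ext_all g_root /model_map_enum root.
have res0 : holds_list rres (nseq y 0) (fn Root point).
  have [ev _] := code_evaluates; apply: ev gy _ _ g_root _ => // j.
  have [/(@ext_all _ (CName _)) arg_init _] :=
    @ext_all _ (CAnd _ _) _ (root j point erefl).
  have [arg_nil /(@ext_all _ (CName _)) tl_nil] := init' _ arg_init.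
  split=> //; split=> //.
  exact/ext_num/(@ext_all _ (CNum _))/init.
have [_ /(@ext_all _ (CName _)) res_nil] :=
  @ext_all _ (CAnd _ _) _ (root true point erefl).
by have /repl_nil/iffLR/(_ res_nil) := res0 true; case: y {gy res0}.
Qed.

End Soundness.

(** * Completeness: computations have models *)

(** A node of the model is a call, given by class, argument list and result list; equal calls of
    equal colour are shared. *)
Notation node := (code * seq nat * seq nat)%type.

Definition computes (p : node) : Prop :=
  let: (c, v, w) := p in
  match c with
  | CF f => exists2 y, reval f v y & w = nseq y 0
  | CV gs => revals gs v w
  | CM f => exists n v' y z, [/\ v = n :: v', w = nseq y 0, n <= y,
      forall m, n <= m < y -> reval f (m :: v') (z m).+1 & reval f (y :: v') 0]
  end.

Section Valuation.

Variables (rho : reg -> seq nat) (kappa : bool -> node).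

(** [rho] gives the contents of the registers of a node and [kappa] its two children. The called
    node must compute too, because only such nodes will belong to a class. *)
Definition atom_valid (t : atom) : Prop :=
  match t with
  | Call a c x y => kappa a = (c, rho x, rho y) /\ computes (c, rho x, rho y)
  | IsHd x y => rho y = nseq (head 0 (rho x)) 0
  | IsTl x y => rho y = behead (rho x)
  | IsNil b x => (rho x == [::]) = b
  end.

Definition rule_valid (r : rule) : Prop :=
  (if r.1 is Some (b, x) then (rho x == [::]) = b else True) -> atom_valid r.2.

End Valuation.

Definition node_valid (p : node) (l : (reg -> seq nat) * (bool -> node)) : Prop :=
  [/\ l.1 rarg = p.1.2, l.1 rres = p.2 &
      foldr (fun r P => rule_valid l.1 l.2 r /\ P) True (rules p.1.1)].

(** Inversion of the last evaluation step: the intermediate values in its premises fill the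
    registers, listed in order of their index, and the premises themselves justify the calls.
    Unlisted registers are empty, and children that are not called are arbitrary. *)
Lemma node_valid_ex p : computes p -> exists l, node_valid p l.
Proof.
move: p => [[[[||[|i]|f gs|f f'|f]|[|f gs]|f] v] w] /=.
- move=> [y fy ->]; inversion fy; subst.
  by exists ((fun x : reg => nth [::] [:: v] x), fun=> (CV [::], [::], [::])).
- move=> [y fy ->]; inversion fy; subst.
  by exists ((fun x : reg => nth [::] [:: v; nseq (head 0 v).+1 0; nseq (head 0 v) 0] x),
    fun=> (CV [::], [::], [::])).
- move=> [y fy ->]; inversion fy; subst.
  exists ((fun x : reg => nth [::] [:: v; nseq (nth 0 v 0) 0] x),
    fun=> (CV [::], [::], [::])).
  by split=> //=; rewrite /rule_valid /= nth0.
- move=> [y fy ->]; inversion fy; subst.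
  exists ((fun x : reg => nth [::] [:: v; nseq (nth 0 v i.+1) 0; [::]; behead v] x),
    fun=> (CF (RProj i), behead v, nseq (nth 0 v i.+1) 0)).
  split=> //=; rewrite /rule_valid /=; do !split=> //.
  by exists (nth 0 v i.+1) => //; rewrite -nth_behead; constructor.
- move=> [y fy ->]; inversion fy; subst.
  exists ((fun x : reg => nth [::] [:: v; nseq y 0; [::]; [::]; [::]; ws] x),
    fun a => if a then (CF f, ws, nseq y 0) else (CV gs, v, ws)).
  split=> //=; rewrite /rule_valid /=; do !split=> //.
  by exists y.
- move=> [y fy ->]; inversion fy; subst.
    exists ((fun x : reg => nth [::] [:: 0 :: v0; nseq y 0; [::]; v0] x),
      fun a => (CF f, v0, nseq y 0)).
    split=> //=; rewrite /rule_valid /=; do !split=> //.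
    by exists y.
  exists ((fun x : reg => nth [::] [:: n.+1 :: v0; nseq y 0; nseq n.+1 0; v0; nseq n 0;
      n :: v0; nseq z 0; [:: n, z & v0]; z :: v0] x),
    fun a => if a then (CF f', [:: n, z & v0], nseq y 0)
             else (CF (RPrec f f'), n :: v0, nseq z 0)).
  split=> //=; rewrite /rule_valid /=; do !split=> //.
    by exists z.
  by exists y.
- move=> [y fy ->]; inversion fy; subst.
  exists ((fun x : reg => nth [::] [:: v; nseq y 0; [::]; [::]; [::]; 0 :: v] x),
    fun a => (CM f, 0 :: v, nseq y 0)).
  split=> //=; rewrite /rule_valid /=; do !split=> //.
  by exists 0, v, y, w0; split=> // m /=; auto.
- move=> fw; inversion fw; subst.
  by exists ((fun x : reg => nth [::] [:: v] x), fun=> (CV [::], [::], [::])).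
- move=> fw; inversion fw; subst.
  exists ((fun x : reg => nth [::] [:: v; w0 :: ws; nseq w0 0; ws] x),
    fun a => if a then (CV gs, v, ws) else (CF f, v, nseq w0 0)).
  split=> //=; rewrite /rule_valid /=; do !split=> //.
  by exists w0.
- move=> [n [v' [y [z [-> -> ny pos zero]]]]].
  (* The value of [f] at the current candidate [n], which is zero exactly when the search stops
     there. *)
  pose val := if n == y then 0 else (z n).+1.
  exists ((fun x : reg => nth [::] [:: n :: v'; nseq y 0; nseq n 0; v'; nseq n.+1 0;
      n.+1 :: v'; nseq val 0] x),
    fun a => if a then (CM f, n.+1 :: v', nseq y 0)
             else (CF f, n :: v', nseq val 0)).
  have [n_y|n_y] := eqVneq n y; rewrite /val.
    subst n; rewrite eqxx.
    split=> //=; rewrite /rule_valid /=; do !split=> //.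
    by exists 0.
  have lt_ny : n < y by rewrite ltn_neqAle n_y.
  rewrite (negPf n_y); split=> //=; rewrite /rule_valid /=; do !split=> //.
    by exists (z n).+1 => //; apply: pos; rewrite leqnn.
  exists n.+1, v', y, z; split=> // m /andP[nm my].
  by apply: pos; rewrite my (ltnW nm).
Qed.

(** * The model of coloured calls and lists *)

Definition element : Type := (bool * (node + seq nat))%type.

HB.instance Definition _ := gen_eqMixin element.
HB.instance Definition _ := gen_choiceMixin element.
HB.instance Definition _ := isPointed.Build element (false, inr [::]).

Definition sort_of (e : element) : bool * bool :=
  (if e.2 is inl _ then true else false, e.1).

Section Model.

Variables (g : recfun) (q : nat).
Hypothesis g_zero : reval g [:: q] 0.

Let local_ex (p : node) : exists l, computes p -> node_valid p l.
Proof.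
have [/node_valid_ex[l pl]|np] := pselect (computes p); first by exists l.
(* Arbitrary data for a call that does not compute; it belongs to no class. *)
by exists ((fun=> [::]), (fun=> p)).
Qed.

Let local (p : node) := projT1 (cid (local_ex p)).

Let localP p : computes p -> node_valid p (local p).
Proof. exact: projT2 (cid (local_ex p)). Qed.

(** Off their intended sort the roles take arbitrary values that respect [target], since
    [functional_axioms] constrain every sort. *)
Definition mfun (r : frole) (e : element) : element :=
  match r with
  | Hd => (~~ e.1, if e.2 is inr v then inr (nseq (head 0 v) 0) else e.2)
  | Tl => (~~ e.1, if e.2 is inr v then inr (behead v) else e.2)
  | Ch a => (~~ e.1, if e.2 is inl n then inl ((local n).2 a) else e.2)
  | Reg x j => (j, inr (if e.2 is inl n then (local n).1 x else [::]))
  | Root => (false, inl (CF g, [:: q], [::]))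
  end.

Lemma sort_mfun r e : sort_of (mfun r e) = target r (sort_of e).
Proof. by case: r e => [|||a|x j] [k [p|v]]. Qed.

(** For composable [a], [b] and [k], the second case is the transitive closure of [a] at the sort of
    [d] and [b] at the next sort. *)
Definition mrole (r : role) (d : element) : set element :=
  match r with
  | inl r => [set mfun r d]
  | inr (a, b, k) => [set e |
      sort_of d = (true, k) /\ (e = mfun a d \/ e = mfun b (mfun a d)) \/
      sort_of d = target a (true, k) /\ e = mfun b d]
  end.

Definition mname (n : nat) : set element :=
  match n with
  | 0 => [set e | (sort_of e).1]
  | 1 => [set e | (sort_of e).2]
  | 2 => [set e | e.2 = inr [::]]
  | 3 => [set e | e.2 = inr [:: q]]
  | n.+4 => [set e | exists p, [/\ e.2 = inl p, computes p & code_num p.1.1 = n]]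
  end.

Definition minterp : interp := @Interp element mname
  (fun n d => [set e | exists2 r, role_num r = n & mrole r d e]).

Local Notation ext := (concept_ext minterp).

#[local] Arguments role_int : simpl never.

Lemma mroleE r (d : element) : @role_int minterp (role_num r) d = mrole r d.
Proof.
by apply/seteqP; split=> [e [r' /role_num_inj ->]|e re] //; exists r.
Qed.

(** Every successor is reached by one or two applications of the finitely many functional roles. *)
Lemma minterp_finite : finitely_branching minterp.
Proof.
move=> d; pose F := \bigcup_(r in [set: frole]) [set mfun r d].
have F_fin : finite_set F.
  by apply: bigcup_finite => [|r _] //; exact: finite_finset.
apply: (@sub_finite_set _ _
  (F `|` \bigcup_(r in [set: frole]) \bigcup_(s in [set: frole])
           [set mfun r (mfun s d)])).
  move=> e [n _ [[r|[[a b] k]] _]] /=; first by move=> ->; left; exists r.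
  case=> [[_ [->|->]]|[_ ->]]; [by left; exists a| |by left; exists b].
  by right; exists b => //; exists a.
rewrite finite_setU; split=> //.
apply: bigcup_finite => [|r _]; first exact: finite_finset.
by apply: bigcup_finite => [|s _] //; exact: finite_finset.
Qed.

Lemma mext_all r C d : ext (CAll r C) d <-> ext C (mfun r d).
Proof.
rewrite /= mroleE /=; split=> [/(_ _ erefl)[]|Cd e ->] //; split=> //.
by exists (role_num (inl r)) => //; rewrite mroleE.
Qed.

Lemma mext_lit b n d : ext (CLit b n) d <-> (ext (CName n) d <-> b).
Proof. by case: b; split=> //= -[H1 H2]; auto => /H1. Qed.

Lemma mext_sort s d : ext (CSort s) d <-> sort_of d = s.
Proof.
case: s => s1 s2.
change (ext (CLit s1 NodeName) d /\ ext (CLit s2 ColourName) d <->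
  sort_of d = (s1, s2)).
rewrite !mext_lit [sort_of d]surjective_pairing /=.
split=> [[/Bool.eq_iff_eq_true -> /Bool.eq_iff_eq_true ->] //|[-> ->]] //.
Qed.

(** Write X, Y, Z for the three sorts. As X and Y differ, the composition role leads from [d] only
    to [mfun a d] and [mfun b (mfun a d)]; the former has sort Y and is cut off by the restriction
    to Z. *)
Lemma mext_agree a b k c d : composable a b k -> sort_of d = (true, k) ->
  mfun b (mfun a d) = mfun c d -> ext (CAgree a b k c) d.
Proof.
move=> /and3P[/=]; rewrite !inE negb_or => /andP[/eqP XY _] /eqP YZ _ dX eq_c.
move=> e /= [+ [/mext_sort eZ _]]; rewrite !mroleE /= -eq_c.
case=> [[_ [e_a|]]|[dY _]] //; first by case: YZ; rewrite -eZ e_a sort_mfun dX.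
by case: XY; apply: etrans (esym dX) dY.
Qed.

(** An element of the last sort has no successor, as that sort differs from the other two. So two
    consecutive steps are an [a]-step and then a [b]-step, and [mrole] contains their
    composition. *)
Lemma composition_model a b k : model minterp (composition_axioms (a, b, k)).
Proof.
rewrite /composition_axioms; case: ifP => [/and3P[/=]|_ ax []].
rewrite !inE negb_or => /andP[/eqP XY /eqP XZ] /eqP YZ _.
move=> ax /= [<-|[<-|[<-|//]]].
- move=> d e f /=; rewrite !mroleE /=.
  have no_out e' : sort_of e' = target b (target a (true, k)) ->
      ~ mrole (inr (a, b, k)) e' f.
    by move=> /= -> [[/esym]|[/esym]].
  case=> [[dX [e_a|e_ab]]|[dY e_b]].
  + case=> [[eX]|[_ ->]]; last by left; rewrite e_a; auto.
    by case: XY; apply: etrans (esym eX) _; rewrite e_a sort_mfun dX.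
  + by move=> /no_out[]; rewrite e_ab !sort_mfun dX.
  + by move=> /no_out[]; rewrite e_b sort_mfun dY.
- move=> d /mext_sort dX e /=; rewrite !mroleE /= => ->; left; auto.
- move=> d /mext_sort dY e /=; rewrite !mroleE /= => ->; right; auto.
Qed.

Lemma functional_model r : model minterp (functional_axioms r).
Proof.
apply/model_cons; split=> [d _|].
  change (0 + 1 * #|` fset_set (@role_int minterp (role_num (inl r)) d)| = 1).
  by rewrite mroleE fset_set1 cardfs1.
apply/model_map_enum => s d /mext_sort ds; apply/mext_all/mext_sort.
by rewrite sort_mfun ds.
Qed.

Lemma agree_axioms_model X a b c : (forall k, composable a b k) ->
  (forall d, ext X d -> mfun b (mfun a d) = mfun c d) ->
  model minterp (agree_axioms X a b c).
Proof.
move=> abk eq_c; apply/model_map_enum => k d [/eq_c eq_cd dk].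
by apply: mext_agree eq_cd => //; apply/mext_sort.
Qed.

Lemma mfun_ch a (d : element) p :
  d.2 = inl p -> (mfun (Ch a) d).2 = inl ((local p).2 a).
Proof. by case: d => k _ /= ->. Qed.

Lemma mfun_reg x j (d : element) p :
  d.2 = inl p -> mfun (Reg x j) d = (j, inr ((local p).1 x)).
Proof. by case: d => k _ /= ->. Qed.

Lemma atom_axioms_model X t :
  (forall d, ext X d -> exists p, [/\ d.2 = inl p, computes p &
     atom_valid (local p).1 (local p).2 t]) ->
  model minterp (atom_axioms X t).
Proof.
case: t => [a c x y|x y|x y|b x] HX.
- apply/model_cons; split.
    move=> d /HX[p [dp _ [eq_p pc]]]; apply/mext_all.
    by exists ((local p).2 a); rewrite (mfun_ch a dp) eq_p.
  apply/model_flat_map_enum => j; apply/model_cat.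
  split; (apply: agree_axioms_model => [k|d]; first by case: j k => -[]).
    move=> /HX[p [dp _ [eq_p pc]]]; have [arg_p _ _] := localP pc.
    by rewrite (mfun_reg _ _ (mfun_ch a dp)) (mfun_reg _ _ dp) eq_p arg_p.
  move=> /HX[p [dp _ [eq_p pc]]]; have [_ res_p _] := localP pc.
  by rewrite (mfun_reg _ _ (mfun_ch a dp)) (mfun_reg _ _ dp) eq_p res_p.
- apply/model_flat_map_enum => j.
  apply: agree_axioms_model => [k|d]; first by case: j k => -[].
  by move=> /HX[p [dp _ eq_y]]; rewrite !(mfun_reg _ _ dp) eq_y.
- apply/model_flat_map_enum => j.
  apply: agree_axioms_model => [k|d]; first by case: j k => -[].
  by move=> /HX[p [dp _ eq_y]]; rewrite !(mfun_reg _ _ dp) eq_y.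
- apply/model_map_enum => j d /HX[p [dp _ <-]].
  apply/mext_all/mext_lit; rewrite (mfun_reg _ _ dp).
  by split=> [[->]|/eqP /= ->].
Qed.

Lemma foldr_In (T : Type) (P : T -> Prop) s x :
  foldr (fun y Q => P y /\ Q) True s -> List.In x s -> P x.
Proof. by elim: s => //= y s IH [Py /IH Ps] [<-|]. Qed.

Lemma code_axioms_model c : model minterp (code_axioms c).
Proof.
apply/model_cons; split; first by move=> [k _] [p [/= -> _ _]].
apply/model_flat_map => r cr; apply: atom_axioms_model => d.
case=> -[p [dp pc /code_num_inj eq_c]] guard_d; exists p; split=> //.
have [_ _] := localP pc; rewrite eq_c => valid; apply: (foldr_In valid cr).
case: r.1 guard_d => // -[b x] /(mext_all _ (CLit _ _))/mext_lit.
rewrite (mfun_reg _ _ dp) => H; apply/idP/idP => [/eqP p_nil|/H[->] //].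
by apply/H; rewrite p_nil.
Qed.

Lemma input_complete : consistent (input_tbox g q).
Proof.
exists minterp; split; first exact: minterp_finite.
have num_ext n k : ext (CNum n) (k, inr (nseq n 0)).
  elim: n k => // n IH k; split; last exact/mext_all/IH.
  by split=> //; apply/(mext_all Hd (CName _)).
apply/model_cons; split.
  move=> [k x] x_init; have -> : x = inr [:: q] by [].
  by apply/mext_all; exact: num_ext.
apply/model_cons; split.
  move=> [k x] x_init; have -> : x = inr [:: q] by [].
  by split=> //; apply/(mext_all Tl (CName _)).
(* The root call has the empty result list, so it computes because [g] yields 0 on [q]. *)
have root_ev : computes (CF g, [:: q], [::]) by exists 0.
have [root_arg root_res _] := localP root_ev.
apply/model_cat; split.
  apply/model_cons; split.
    move=> d _; apply/(mext_all Root (CName _)).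
    by exists (CF g, [:: q], [::]); split.
  apply/model_map_enum => j d _; apply/mext_all; split.
    apply/(mext_all _ (CName _)).
    by rewrite (@mfun_reg _ _ _ (CF g, [:: q], [::])) // root_arg.
  apply/(mext_all _ (CName _)).
  by rewrite (@mfun_reg _ _ _ (CF g, [:: q], [::])) // root_res.
apply/model_cat; split; last first.
  by apply/model_flat_map => c _; exact: code_axioms_model.
apply/model_cat; split.
  by apply/model_flat_map_enum; exact: functional_model.
apply/model_cat; split.
  by apply/model_flat_map_enum => -[[a b] k]; exact: composition_model.
move=> ax [<-|[<-|[]]] [k x] x_nil; have -> : x = inr [::] by [].
  exact/(mext_all Hd (CName _)).
exact/(mext_all Tl (CName _)).
Qed.

End Model.

(** * The diagonal argument *)

Lemma input_tbox_consistent g n y : reval g [:: n] y ->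
  consistent (input_tbox g n) <-> y = 0.
Proof.
move=> gy; split=> [[I [I_fin /model_cons[init prog]]]|y0].
  exact: input_sound init gy.
by apply: input_complete; rewrite -y0.
Qed.

(** * Syntactic restrictions on the TBoxes *)

Definition plain (C : concept) : bool := ~~ has numerical (concept_constraints C).

(** The shapes of axioms that occur: numerical constraints come only from functionality, and
    transitivity is stated only for composition roles. *)
Inductive admissible : axiom -> Prop :=
  | admissible_plain C D : plain C -> plain D -> admissible (CI C D)
  | admissible_functional r : admissible (CI CTop (CFunct r))
  | admissible_trans a b k : admissible (Trans (comp_num a b k)).

Lemma plain_and C D : plain (CAnd C D) = plain C && plain D.
Proof. by rewrite /plain /= has_cat negb_or. Qed.

Lemma plain_all r C : plain (CAll r C) = plain C.
Proof. by []. Qed.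

Lemma plain_lit b n : plain (CLit b n).
Proof. by case: b. Qed.

Lemma plain_sort s : plain (CSort s).
Proof. by rewrite plain_and !plain_lit. Qed.

Lemma plain_agree a b k c : plain (CAgree a b k c).
Proof.
by have := plain_sort (target b (target a (true, k))); rewrite /plain /= !cats0.
Qed.

Lemma plain_guard G : plain (CGuard G).
Proof. by case: G => [[b x]|] //; rewrite plain_all plain_lit. Qed.

Lemma plain_num n : plain (CNum n).
Proof. by elim: n => // n IH; rewrite plain_and plain_all. Qed.

Lemma atom_admissible X t : plain X -> List.Forall admissible (atom_axioms X t).
Proof.
move=> X_plain.
have agr a b c : List.Forall admissible (agree_axioms X a b c).
  apply/List.Forall_map/List.Forall_forall => k _; constructor.
    by rewrite plain_and X_plain plain_sort.
  exact: plain_agree.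
case: t => [a c x y|x y|x y|b x] /=.
- constructor; first by constructor.
  apply/List.Forall_flat_map/List.Forall_forall => j _.
  exact/List.Forall_app.
- by apply/List.Forall_flat_map/List.Forall_forall => j _.
- by apply/List.Forall_flat_map/List.Forall_forall => j _.
- apply/List.Forall_map/List.Forall_forall => j _; constructor=> //.
  by rewrite plain_all plain_lit.
Qed.

Lemma code_admissible c : List.Forall admissible (code_axioms c).
Proof.
constructor; first by constructor.
apply/List.Forall_flat_map/List.Forall_forall => r _.
by apply: atom_admissible; rewrite plain_and plain_guard.
Qed.

Lemma frame_admissible : List.Forall admissible frame_axioms.
Proof.
rewrite /frame_axioms; apply/List.Forall_app; split; last (apply/List.Forall_app; split).
- apply/List.Forall_flat_map/List.Forall_forall => r _.
  constructor; first by constructor.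
  apply/List.Forall_map/List.Forall_forall => s _; constructor.
    exact: plain_sort.
  by rewrite plain_all plain_sort.
- apply/List.Forall_flat_map/List.Forall_forall => -[[a b] k] _.
  rewrite /composition_axioms; case: ifP => _ //.
  by do 3! [constructor]; rewrite ?plain_sort //; constructor; rewrite ?plain_sort.
- by do 2! [constructor; first by constructor].
Qed.

Lemma input_admissible g n : List.Forall admissible (input_tbox g n).
Proof.
constructor; first by constructor; rewrite ?plain_all ?plain_num.
constructor; first by constructor.
apply/(List.Forall_app _ (root_axioms g)); split.
  constructor; first by constructor.
  by apply/List.Forall_map/List.Forall_forall => j _; constructor.
apply/List.Forall_app; split; first exact: frame_admissible.
by apply/List.Forall_flat_map/List.Forall_forall => c _; exact: code_admissible.
Qed.

Lemma has_In (T : Type) (p : pred T) s x : List.In x s -> p x -> has p s.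
Proof. by elim: s => //= y s IH [->|/IH H] px; rewrite ?px // H ?orbT. Qed.

Lemma admissible_numerical T con : List.Forall admissible T ->
  List.In con (tbox_constraints T) -> numerical con ->
  exists r, con = NumEq (PAdd (PConst 0) 1 (SFun r)) (PConst 1).
Proof.
have plainN C : plain C -> List.In con (concept_constraints C) ->
    ~~ numerical con.
  by move=> C_plain C_con; apply: contra C_plain; exact: has_In.
elim=> // ax {}T ax_adm _ IH /List.in_app_iff[|/IH //] ax_con con_num.
case: ax_adm ax_con => [C D /plainN HC /plainN HD|r|//].
  by move/List.in_app_iff=> [/HC|/HD]; rewrite con_num.
move=> /= [eq_con|[<-|//]]; last by exists r.
by rewrite -eq_con in con_num.
Qed.

Lemma admissible_transitive T n : List.Forall admissible T ->
  n \in transitive_roles T -> exists a b k, n = comp_num a b k.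
Proof.
elim=> // ax {}T ax_adm _ IH.
case: ax_adm => [C D _ _|r|a b k]; rewrite /transitive_roles /= //.
by rewrite in_cons => /orP[/eqP ->|/IH //]; exists a, b, k.
Qed.

Lemma input_restricted g n :
  no_transitive_role_in_numerical (input_tbox g n) /\
  constants_zero_one (input_tbox g n).
Proof.
have adm := input_admissible g n; split=> con T_con con_num m.
  have [r ->] := admissible_numerical adm T_con con_num.
  rewrite inE => /eqP ->; apply/negP.
  (* Functional roles lie in the left summand of [role], transitive ones in the right. *)
  by case/(admissible_transitive adm)=> a [b [k /role_num_inj]].
have [r ->] := admissible_numerical adm T_con con_num.
by rewrite !inE => /or3P[] /eqP ->; auto.
Qed.

(** The tags 3, 0 and 1 are those of [CSucc], [SetSub] and [SConcept]: this is the code of [CAll] as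
    a function of the codes of its role term and its concept. *)
Definition all_code (r m : nat) : nat :=
  Cantor.to_nat (3, Cantor.to_nat (0, Cantor.to_nat (r, Cantor.to_nat (1, m)))).

Lemma recursive_all_code r F :
  recursive F -> recursive (fun v => all_code r (F v)).
Proof. by move=> rF; do ![apply: recursive_pair; first exact: recursive_const]. Qed.

Definition and_all_code (c r m : nat) : nat :=
  Cantor.to_nat (2, Cantor.to_nat (c, all_code r m)).

Lemma concept_code_and_all C r D : concept_code (CAnd C (CAll r D)) =
  and_all_code (concept_code C) (sterm_code (SFun r)) (concept_code D).
Proof. by []. Qed.

Lemma axiom_code_all C r D : axiom_code (CI C (CAll r D)) =
  Cantor.to_nat (0, Cantor.to_nat (concept_code C,
    all_code (sterm_code (SFun r)) (concept_code D))).
Proof. by []. Qed.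

Lemma recursive_iterates (a h : nat -> nat) F :
  (forall n, a n.+1 = h (a n)) -> recursive (fun v => h (nth 0 v 1)) ->
  recursive F -> recursive (fun v => a (F v)).
Proof.
move=> aS rh rF.
have -> : (fun v => a (F v)) = (fun v => nat_rec _ (a 0) (fun=> h) (F v)).
  by apply/funext => v; elim: (F v) => //= n <-.
by apply: (recursive_rec (a := fun=> a 0) (G := fun=> 0)) => //;
  exact: recursive_const.
Qed.

Lemma recursive_init F : recursive F ->
  recursive (fun v => axiom_code (init_axiom (F v))).
Proof.
move=> rF.
have num : recursive (fun v => concept_code (CNum (F v))).
  apply: (recursive_iterates (a := fun n => concept_code (CNum n))
    (fun n => concept_code_and_all _ _ (CNum n))) rF.
  do 2! [apply: recursive_pair; first exact: recursive_const].
  exact/recursive_all_code/recursive_proj.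
under eq_fun do rewrite axiom_code_all.
do 2! [apply: recursive_pair; first exact: recursive_const].
exact: recursive_all_code.
Qed.

Theorem theorem6 :
  undecidable_on (fun _ : tbox => True) consistent /\
  undecidable_on
    (fun T : tbox => no_transitive_role_in_numerical T /\ constants_zero_one T)
    consistent.
Proof.
suff H : undecidable_on
    (fun T : tbox => no_transitive_role_in_numerical T /\ constants_zero_one T)
    consistent.
  by split=> // -[f fP]; apply: H; exists f => T _; exact: fP.
move=> [f fP].
(* [s] prepends the input axiom for [n] to the TBox with code [n]; the outer successor is that of
   [tbox_code] on a nonempty list. *)
have [s sP] : recursive (fun v =>
    (Cantor.to_nat (axiom_code (init_axiom (nth 0 v 0)), nth 0 v 0)).+1).
  apply/recursive_succ/recursive_pair; last exact: recursive_proj.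
  exact/recursive_init/recursive_proj.
pose g := RComp f [:: s]; pose q := tbox_code (program_tbox g).
have g_f y : reval f [:: tbox_code (input_tbox g q)] y -> reval g [:: q] y.
  by move=> fy; apply: (reval_comp _ fy); do 2! [constructor => //]; exact: (sP [:: q]).
have [f1 f0] := fP _ (input_restricted g q).
(* If the TBox is consistent, [f] and hence [g] yield 1, and consistency forces 1 = 0. If not, [g]
   yields 0 on [q], which makes the TBox consistent. *)
have [cons|incons] := pselect (consistent (input_tbox g q)).
  by have /input_tbox_consistent/iffLR/(_ cons) := g_f _ (f1 cons).
by apply: (incons); apply/(input_tbox_consistent (g_f _ (f0 incons))).
Qed.
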